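(* Let $G$ be a finite group and let $\mathcal{I}=(\rho_1,\ldots,\rho_\lambda)$ be a $\lambda$-tuple of (not necessarily distinct) faithful permutation representations of $G$ in the symmetric group $S_n$ on $\{1,\ldots,n\}$, with images $G_i=\rho_i(G)$. For each $i$ let $\alpha_i:G_1\to G_i$ be the isomorphism given by $\rho_1^{-1}$ (defined on $G_1$) followed by $\rho_i$. Assume that each $G_i$ is permutationally isomorphic to $G_1$, and let $\psi_1,\ldots,\psi_\lambda$ be bijections of $\{1,\ldots,n\}$ such that $(\psi_i,\alpha_i)$ is a permutational isomorphism from $G_1$ to $G_i$ for $1\leq i\leq\lambda$. Let $\delta_{\mathrm{tw}}$ be the minimum distance of the twisted permutation code $\mathrm{Tw}(G,\mathcal{I})$, let $r_{\mathrm{tw}}=\lfloor(\delta_{\mathrm{tw}}-1)/2\rfloor$ and $r'=\lfloor r_{\mathrm{tw}}/\lambda\rfloor$, and let $\mathcal{U}$ be an uncovering-by-bases of strength $r'$ for $G_1$. Suppose that the codeword $\mathbf{g}=[\rho_1(g)\mid\cdots\mid\rho_\lambda(g)]$, where $g\in G$, is transmitted and that the received word $\mathbf{w}=[w_1\mid\cdots\mid w_\lambda]$ contains at most $r_{\mathrm{tw}}$ errors. Then the decoding algorithm described in the context, run on input $\mathbf{w}$, is guaranteed to decode successfully, i.e. to return $\mathbf{g}$, after at most $\lambda|\mathcal{U}|$ attempts.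
   Context: Permutations act on the right, $x\mapsto x^g$. A permutation $g$ of $\{1,\ldots,n\}$ is written in list form as the word $[1^g,2^g,\ldots,n^g]$. The twisted permutation code is $\mathrm{Tw}(G,\mathcal{I})=\{[\rho_1(g)\mid\rho_2(g)\mid\cdots\mid\rho_\lambda(g)] : g\in G\}$, where each codeword is the concatenation of the list forms of the $\rho_i(g)$ and so has length $\lambda n$. Minimum distance means minimum Hamming distance between distinct codewords; the number of errors in $\mathbf{w}$ is its Hamming distance from $\mathbf{g}$. The subwords $w_1,\ldots,w_\lambda$, each of length $n$, are the components of $\mathbf{w}$. A base for a permutation group $H$ acting on a finite set $\Omega$ is a subset of $\Omega$ whose pointwise stabilizer in $H$ is trivial. For $r\geq 0$, an uncovering-by-bases of strength $r$ for $H$ is a collection $\mathcal{U}$ of bases for $H$ such that every $r$-subset of $\Omega$ is disjoint from at least one base in $\mathcal{U}$. Let $H_1$ and $H_2$ be groups acting on $\Omega_1$ and $\Omega_2$. A permutational isomorphism from $H_1$ to $H_2$ is a pair $(\psi,\varphi)$ where $\varphi:H_1\to H_2$ is a group isomorphism and $\psi:\Omega_1\to\Omega_2$ is a bijection with $\psi(x^h)=(\psi(x))^{(h^\varphi)}$ for all $x\in\Omega_1$ and $h\in H_1$; if such a pair exists, $H_1$ and $H_2$ are called permutationally isomorphic. Decoding algorithm: fix an ordering $B_1,B_2,\ldots$ of the bases in $\mathcal{U}$. For $j=1,2,\ldots$ in turn and, for each $j$, for $i=1,\ldots,\lambda$ in turn, make the following attempt. Examine the symbols of $w_i$ in the positions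 indexed by $\psi_i(B_j)$. If there are no repeated symbols, find (if it exists) the unique element $h_i\in G_i$ whose list form agrees with $w_i$ in those positions. Compute $h_i^{\alpha_i^{-1}}\in G_1$ and its images $h_i^{\alpha_i^{-1}\alpha_m}\in G_m$ for $m=1,\ldots,\lambda$ (maps composed left to right), and form the codeword $\mathbf{h}=[h_i^{\alpha_i^{-1}\alpha_1}\mid\cdots\mid h_i^{\alpha_i^{-1}\alpha_\lambda}]\in\mathrm{Tw}(G,\mathcal{I})$. If $\mathbf{h}$ is within Hamming distance $r_{\mathrm{tw}}$ of $\mathbf{w}$, return $\mathbf{h}$ (necessarily $\mathbf{h}=\mathbf{g}$) and stop. In all other cases the attempt is unsuccessful and the algorithm proceeds to the next attempt. *)

(* Defs.v *)
From mathcomp Require Import all_boot all_fingroup.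

Set Implicit Arguments.
Unset Strict Implicit.
Unset Printing Implicit Defensive.

Section Words.

Variables (T : finType) (l n : nat).

Definition hamming m (u v : m.-tuple T) : nat :=
  #|[set k : 'I_m | tnth u k != tnth v k]|.

(* Relational, since a code with fewer than two words has no minimum          *)
(* distance.                                                                  *)
Definition is_min_distance m (C : {set m.-tuple T}) (d : nat) : Prop :=
  (exists u v, [/\ u \in C, v \in C, u != v & hamming u v = d])
  /\ (forall u v, u \in C -> v \in C -> u != v -> d <= hamming u v).

Fact concat_key (c : 'I_l -> n.-tuple T) :
  size (flatten [seq tval (c i) | i <- enum 'I_l]) == l * n.
Proof.
rewrite size_flatten /shape -map_comp (eq_map (g := fun=> n)); last first.
  by move=> i /=; rewrite size_tuple.
by rewrite sumnE big_map big_enum /= sum_nat_const card_ord.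
Qed.

Definition concat (c : 'I_l -> n.-tuple T) : (l * n).-tuple T :=
  Tuple (concat_key c).

Fact component_key (w : (l * n).-tuple T) (i : 'I_l) :
  size (take n (drop (i * n) w)) == n.
Proof.
rewrite size_take_min size_drop size_tuple -mulnBl.
by apply/eqP/minn_idPl; rewrite leq_pmull // subn_gt0.
Qed.

Definition component (w : (l * n).-tuple T) (i : 'I_l) : n.-tuple T :=
  Tuple (component_key w i).

End Words.

Definition list_form n (s : 'S_n) : n.-tuple 'I_n := [tuple s x | x < n].

Definition is_base (T : finType) (H : {set {perm T}}) (B : {set T}) : bool :=
  'C_H(B | 'P)%g == 1%g.

Definition uncovering_by_bases (T : finType) (H : {set {perm T}}) (r : nat)
    (U : {set {set T}}) : Prop :=
  {in U, forall B, is_base H B}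
  /\ (forall R : {set T}, #|R| = r -> exists2 B, B \in U & [disjoint R & B]).

Definition permutational_isomorphism (T1 T2 : finType)
    (H1 : {group {perm T1}}) (H2 : {group {perm T2}})
    (psi : T1 -> T2) (phi : {perm T1} -> {perm T2}) : Prop :=
  [/\ bijective psi, misom H1 H2 phi
    & forall x h, h \in H1 -> psi (h x) = phi h (psi x)].

Definition permutationally_isomorphic (T1 T2 : finType)
    (H1 : {group {perm T1}}) (H2 : {group {perm T2}}) : Prop :=
  exists psi phi, permutational_isomorphism H1 H2 psi phi.

(* [search f s] tries [f] on the elements of [s] in turn and stops at the     *)
(* first success; it returns the outcome and the number of attempts made.     *)
Fixpoint search (A R : Type) (f : A -> option R) (s : seq A) : option R * nat :=
  if s is a :: s' then
    if f a is Some x then (Some x, 1%N)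
    else let: (o, k) := search f s' in (o, k.+1)
  else (None, 0%N).

Section TwistedPermutationCode.

(* The number of representations is l.+1, and [rho ord0] is the first one.    *)
Variables (gT : finGroupType) (G : {group gT}) (n l : nat).
Variable rho : 'I_l.+1 -> {morphism G >-> 'S_n}.

Definition codeword (g : gT) : (l.+1 * n).-tuple 'I_n :=
  concat (fun i => list_form (rho i g)).

Definition Tw : {set (l.+1 * n).-tuple 'I_n} := [set codeword g | g in G].

Hypothesis rho_inj : forall i, ('injm (rho i))%g.

(* Meaningful only on the image of [rho ord0], as [invm] is arbitrary outside. *)
Definition alpha (i : 'I_l.+1) (h : 'S_n) : 'S_n :=
  rho i (invm (rho_inj ord0) h).

Fact alphaM i : {in (rho ord0 @* G)%g &, {morph alpha i : x y / (x * y)%g}}.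
Proof.
move=> _ _ /morphimP[x Gx _ ->] /morphimP[y Gy _ ->].
by rewrite /alpha -morphM ?invmE ?groupM // morphM.
Qed.
Canonical alpha_morphism i := Morphism (alphaM i).

Fact injm_alpha i : ('injm (alpha i))%g.
Proof.
apply/injmP=> _ _ /morphimP[x Gx _ ->] /morphimP[y Gy _ ->].
by rewrite /= /alpha !invmE // => /(injmP (rho_inj i)) ->.
Qed.

Definition alpha_inv (i : 'I_l.+1) : 'S_n -> 'S_n := invm (injm_alpha i).

Variable psi : 'I_l.+1 -> {perm 'I_n}.

(* The attempt with the base [B] and the component [i]; [None] means that it  *)
(* is unsuccessful. [unset1 A] is [Some h] if [A = [set h]], else [None].     *)
Definition attempt (r : nat) (w : (l.+1 * n).-tuple 'I_n)
    (B : {set 'I_n}) (i : 'I_l.+1) : option ((l.+1 * n).-tuple 'I_n) :=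
  let wi := component w i in
  let P := psi i @: B in
  if dinjectiveb (tnth wi) (mem P) then
    if unset1 [set h in (rho i @* G)%g |
                [forall x in P, tnth (list_form h) x == tnth wi x]] is Some h
    then
      let c := concat (fun m => list_form (alpha m (alpha_inv i h))) in
      if hamming c w <= r then Some c else None
    else None
  else None.

Definition decode (Bs : seq {set 'I_n}) (r : nat)
    (w : (l.+1 * n).-tuple 'I_n) : option ((l.+1 * n).-tuple 'I_n) * nat :=
  search (fun a => attempt r w a.1 a.2)
    [seq (B, i) | B <- Bs, i <- enum 'I_l.+1].

End TwistedPermutationCode.

(* Main.v *)
Require Import Defs.
From mathcomp Require Import all_boot all_fingroup.

Set Implicit Arguments.
Unset Strict Implicit.
Unset Printing Implicit Defensive.

(** Two facts carry the proof. They are kept apart so that the order in which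
    the attempts are made never matters.

    Soundness: an attempt only ever returns a codeword within [r_tw] of [w].
    The transmitted word is also within [r_tw] of [w], and [2 r_tw < delta_tw],
    so the two coincide ([attempt_sound] with [decoding_unique]).

    Completeness: the at most [r_tw] errors are shared among [l.+1] components,
    so some component [i] contains at most [r'] of them
    ([component_few_errors]). The pull-back along [psi i] of its erroneous
    positions has at most [r'] points, so it misses some base [B] in [U]
    ([uncovering_le]). The component [i] is therefore correct on [psi i @: B],
    which is a base for [rho i @* G] because permutational isomorphisms carry
    bases to bases ([is_base_imset]). Hence the symbols read there determine
    [rho i g], from which the other components are recomputed
    ([attempt_complete]).

    The search therefore stops within the list of all pairs of a base and a
    component, of which there are [l.+1 * #|U|], and returns the transmitted
    word. *)

(** * Words and their components *)

Fact block_pos_key l n (i : 'I_l) (x : 'I_n) : i * n + x < l * n.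
Proof.
by rewrite (@leq_trans (i.+1 * n)) ?leq_mul2r ?ltn_ord ?orbT //
  mulSn addnC ltn_add2r.
Qed.

Definition block_pos l n (i : 'I_l) (x : 'I_n) : 'I_(l * n) :=
  Ordinal (block_pos_key i x).

Lemma block_pos_inj l n :
  injective (fun p : 'I_l * 'I_n => block_pos p.1 p.2).
Proof.
case=> [i x] [j y] /(congr1 val) /= E.
have n0 : 0 < n by apply: leq_ltn_trans (ltn_ord x).
have /val_inj-> : i = j :> nat.
  have := congr1 (divn^~ n) E.
  by rewrite !divnMDl // !divn_small ?addn0.
have /val_inj-> // : x = y :> nat.
by have := congr1 (modn^~ n) E; rewrite !modnMDl !modn_small.
Qed.

Lemma tnth_component (T : finType) l n (w : (l * n).-tuple T)
    (i : 'I_l) (x : 'I_n) :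
  tnth (component w i) x = tnth w (block_pos i x).
Proof.
pose d := tnth w (block_pos i x).
by rewrite !(tnth_nth d) /= nth_take // nth_drop.
Qed.

Lemma component_concat (T : finType) l n (c : 'I_l -> n.-tuple T) i :
  component (concat c) i = c i.
Proof.
apply: val_inj => /=; set ss := [seq tval (c j) | j <- enum 'I_l].
have sh : shape ss = nseq l n.
  rewrite /shape -map_comp (eq_map (g := fun=> n)).
    by rewrite -[l in RHS]size_enum_ord; elim: (enum _) => //= j s ->.
  by move=> j /=; rewrite size_tuple.
have := nth_reshape (shape ss) (flatten ss) i.
rewrite flattenK sh nth_nseq ltn_ord take_nseq 1?ltnW // sumn_nseq mulnC => <-.
by rewrite (nth_map i) ?size_enum_ord // nth_ord_enum.
Qed.

Lemma hamming_sym (T : finType) m (u v : m.-tuple T) :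
  hamming u v = hamming v u.
Proof. by apply: eq_card => k; rewrite !inE eq_sym. Qed.

Lemma hamming_triangle (T : finType) m (u v w : m.-tuple T) :
  hamming u w <= hamming u v + hamming v w.
Proof.
apply: leq_trans (leq_card_setU _ _); apply/subset_leq_card/subsetP=> k.
rewrite !inE; apply: contraR; rewrite negb_or !negbK.
by case/andP=> /eqP-> /eqP->.
Qed.

Lemma hamming_eq0 (T : finType) m (u v : m.-tuple T) :
  hamming u v = 0 -> u = v.
Proof.
move/eqP; rewrite cards_eq0 => /eqP E; apply: eq_from_tnth => k.
by have := in_set0 k; rewrite -E inE => /negbFE/eqP.
Qed.

Lemma hamming_max (T : finType) m (u v : m.-tuple T) : hamming u v <= m.
Proof. by rewrite -[leqRHS]card_ord max_card. Qed.

Lemma sum_hamming_component (T : finType) l n (u v : (l * n).-tuple T) :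
  \sum_(i < l) hamming (component u i) (component v i) <= hamming u v.
Proof.
have -> : \sum_(i < l) hamming (component u i) (component v i)
    = #|[set p : 'I_l * 'I_n
         | tnth u (block_pos p.1 p.2) != tnth v (block_pos p.1 p.2)]|.
  pose err i x := tnth u (@block_pos l n i x) != tnth v (block_pos i x).
  transitivity (\sum_(i < l) \sum_(x < n | err i x) 1).
    apply: eq_bigr => i _; rewrite /hamming -sum1_card.
    by apply: eq_bigl => x; rewrite inE !tnth_component.
  rewrite pair_big_dep -sum1_card /=.
  by apply: eq_bigl => p; rewrite inE.
rewrite -(card_imset _ (@block_pos_inj l n)).
by apply/subset_leq_card/subsetP=> _ /imsetP[p + ->]; rewrite !inE.
Qed.

(** Pigeonhole: were every component to exceed the average, the total would
    exceed [r]. *)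
Lemma component_few_errors (T : finType) l n (u v : (l.+1 * n).-tuple T) r :
  hamming u v <= r ->
  exists i, hamming (component u i) (component v i) <= r %/ l.+1.
Proof.
move=> le_r; apply/existsP; apply: contraLR le_r.
rewrite negb_exists => /forallP many; rewrite -ltnNge.
apply: leq_trans (ltn_ceil r (ltn0Sn l)) _.
apply: leq_trans (sum_hamming_component u v).
have -> : (r %/ l.+1).+1 * l.+1 = \sum_(i < l.+1) (r %/ l.+1).+1.
  by rewrite sum_nat_const card_ord mulnC.
by apply: leq_sum => i _; rewrite ltnNge.
Qed.

Lemma min_distance_gt0 (T : finType) m (C : {set m.-tuple T}) d :
  is_min_distance C d -> 0 < d.
Proof.
case=> [[u [v [_ _ uv <-]]] _]; rewrite lt0n.
by apply: contraNneq uv => /hamming_eq0->.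
Qed.

(** Two such codewords are at distance at most twice the radius, which is
    strictly below [d] because [d] is positive. *)
Lemma decoding_unique (T : finType) m (C : {set m.-tuple T}) d
    (w c c' : m.-tuple T) :
  is_min_distance C d -> c \in C -> c' \in C ->
  hamming c w <= (d - 1) %/ 2 -> hamming c' w <= (d - 1) %/ 2 -> c = c'.
Proof.
move=> dP Cc Cc' cw c'w; apply/eqP/negPn/negP=> /(dP.2 _ _ Cc Cc').
apply/negP; rewrite -ltnNge.
apply: leq_ltn_trans (hamming_triangle c w c') _; rewrite (hamming_sym w).
apply: leq_ltn_trans (leq_add cw c'w) _.
rewrite addnn -muln2 (leq_ltn_trans (leq_divM _ _)) //.
by rewrite subn1 prednK // (min_distance_gt0 dP).
Qed.

(** * Bases *)

Lemma is_baseP (T : finType) (H : {group {perm T}}) (B : {set T}) :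
  is_base H B <->
  {in H &, forall x y : {perm T}, {in B, x =1 y} -> x = y}.
Proof.
split=> [/eqP bB x y Hx Hy xy | bB].
  suffices : (x * y^-1)%g \in 'C_H(B | 'P)%g.
    by rewrite bB => /set1gP/eqP; rewrite -eq_mulgV1 => /eqP.
  rewrite inE groupM ?groupV //; apply/astabP=> b Bb /=.
  by rewrite /aperm permM xy // permK.
apply/eqP/trivgP/subsetP=> x /setIP[Hx /astabP fixB]; apply/set1gP.
by apply: bB => // b Bb; rewrite perm1 -[RHS](fixB _ Bb).
Qed.

(** If [phi x] and [phi y] agree on [psi @: B], then [x] and [y] agree on [B],
    since [psi] intertwines the two actions and is injective. *)
Lemma is_base_imset (T1 T2 : finType)
    (H1 : {group {perm T1}}) (H2 : {group {perm T2}}) psi phi (B : {set T1}) :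
  permutational_isomorphism H1 H2 psi phi ->
  is_base H1 B -> is_base H2 (psi @: B).
Proof.
case=> psi_bij /misomP[phiM /isomP[_ im_phi]] psi_phi /is_baseP bB.
apply/is_baseP=> h k; rewrite -im_phi.
case/morphimP=> x Hx _ -> /morphimP[y Hy _ ->] /=; rewrite !morphmE => xy.
congr (phi _); apply: bB => // b Bb; apply: (bij_inj psi_bij).
by rewrite !psi_phi // xy // imset_f.
Qed.

(** A smaller set is first enlarged to exactly [r] points; the bound on [r]
    provides the room. *)
Lemma uncovering_le (T : finType) (H : {set {perm T}}) r
    (U : {set {set T}}) (R : {set T}) :
  uncovering_by_bases H r U -> r <= #|T| -> #|R| <= r ->
  exists2 B, B \in U & [disjoint R & B].
Proof.
case=> _ uncov r_max R_le.
have : 0 < #|[set A : {set T} | A \subset ~: R & #|A| == r - #|R|]|.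
  by rewrite cards_draws bin_gt0 (cardsCs (~: R)) setCK leq_sub2r.
case/card_gt0P=> A; rewrite inE => /andP[sAR /eqP cA].
case: (uncov (R :|: A)).
  have -> : #|R :|: A| = #|R| + #|A|.
    rewrite cardsU disjoint_setI0 ?cards0 ?subn0 //.
    by rewrite disjoint_sym disjoints_subset.
  by rewrite cA subnKC.
by move=> B UB dB; exists B => //; apply: disjointWl dB; apply: subsetUl.
Qed.

(** * The decoding algorithm *)

(** Since every success returns the same [y], it does not matter which element
    of [s] succeeds first: one known success anywhere in [s] decides the
    outcome. *)
Lemma searchP (A : eqType) (R : Type) (f : A -> option R) (s : seq A) y :
  (forall a x, f a = Some x -> x = y) ->
  (exists2 a, a \in s & f a = Some y) ->
  exists2 k, k <= size s & search f s = (Some y, k).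
Proof.
move=> sound; elim: s => [|a s IHs] [b] //=.
case fa: (f a) => [x|]; first by exists 1; rewrite // (sound _ _ fa).
rewrite inE => /predU1P[-> | sb fb]; first by rewrite fa.
by have [|k k_le ->] := IHs; [exists b | exists k.+1].
Qed.

(** The maps [alpha] are transported through [rho ord0], so one component of a
    codeword determines all the others. *)
Lemma decoded_codeword (gT : finGroupType) (G : {group gT}) n l
    (rho : 'I_l.+1 -> {morphism G >-> 'S_n})
    (rho_inj : forall i, ('injm (rho i))%g) i x :
  x \in G ->
  concat (fun m => list_form (alpha rho_inj m (alpha_inv rho_inj i (rho i x))))
  = codeword rho x.
Proof.
move=> Gx; have alphaE m : alpha rho_inj m (rho ord0 x) = rho m x.
  by rewrite /alpha invmE.
have -> : alpha_inv rho_inj i (rho i x) = rho ord0 x.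
  rewrite -(alphaE i) /alpha_inv.
  by rewrite (invmE (injm_alpha rho_inj i)) // mem_morphim.
apply: val_inj; congr (flatten _).
by apply: eq_map => m /=; rewrite alphaE.
Qed.

Lemma attempt_sound (gT : finGroupType) (G : {group gT}) n l
    (rho : 'I_l.+1 -> {morphism G >-> 'S_n})
    (rho_inj : forall i, ('injm (rho i))%g)
    (psi : 'I_l.+1 -> {perm 'I_n}) r w B i c :
  attempt rho_inj psi r w B i = Some c -> c \in Tw rho /\ hamming c w <= r.
Proof.
rewrite /attempt; case: ifP => // _; set A := [set _ in _ | _].
have := unset1K A; case: (unset1 A) => //= h E.
have : h \in (rho i @* G)%g by have := set11 h; rewrite E inE => /andP[].
case/morphimP=> x Gx _ ->; rewrite (decoded_codeword _ _ Gx).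
by case: ifP => // le_r [<-]; rewrite imset_f.
Qed.

(** Agreement with the permutation [rho i g] rules out repeated symbols among
    those read, and no other element of [rho i @* G] agrees with it on a
    base. *)
Lemma attempt_complete (gT : finGroupType) (G : {group gT}) n l
    (rho : 'I_l.+1 -> {morphism G >-> 'S_n})
    (rho_inj : forall i, ('injm (rho i))%g)
    (psi : 'I_l.+1 -> {perm 'I_n}) r w (B : {set 'I_n}) i g :
  g \in G -> hamming (codeword rho g) w <= r ->
  is_base (rho i @* G)%g (psi i @: B) ->
  {in psi i @: B, forall x, tnth (component w i) x = rho i g x} ->
  attempt rho_inj psi r w B i = Some (codeword rho g).
Proof.
move=> Gg le_r /is_baseP base_P wP; rewrite /attempt ifT; last first.
  by apply/dinjectiveP=> x y Px Py; rewrite !wP // => /perm_inj.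
have Gi : rho i g \in (rho i @* G)%g by rewrite mem_morphim.
set A := [set _ in _ | _]; have -> : A = [set rho i g].
  apply/setP=> h; rewrite !inE; apply/andP/eqP=> [[Gh /forall_inP hP] | ->].
    apply: base_P => // x Px.
    by have /eqP := hP x Px; rewrite tnth_mktuple wP.
  by split=> //; apply/forall_inP=> x Px; rewrite tnth_mktuple wP.
by rewrite set1K (decoded_codeword _ _ Gg) le_r.
Qed.

Theorem mainTheorem1
  (gT : finGroupType) (G : {group gT}) (n l : nat)
  (rho : 'I_l.+1 -> {morphism G >-> 'S_n})
  (rho_inj : forall i, ('injm (rho i))%g)
  (Giso : forall i, permutationally_isomorphic
            (rho ord0 @* G)%G (rho i @* G)%G)
  (psi : 'I_l.+1 -> {perm 'I_n})
  (psi_alpha : forall i, permutational_isomorphism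
                 (rho ord0 @* G)%G (rho i @* G)%G (psi i) (alpha rho_inj i))
  (delta_tw : nat) (delta_twP : is_min_distance (Tw rho) delta_tw)
  (r_tw : nat) (r_twE : r_tw = (delta_tw - 1) %/ 2)
  (r' : nat) (r'E : r' = r_tw %/ l.+1)
  (U : {set {set 'I_n}}) (U_ubb : uncovering_by_bases (rho ord0 @* G)%g r' U)
  (Bs : seq {set 'I_n}) (Bs_order : perm_eq Bs (enum U))
  (g : gT) (Gg : g \in G)
  (w : (l.+1 * n).-tuple 'I_n) (w_err : hamming w (codeword rho g) <= r_tw) :
  exists2 k : nat, k <= l.+1 * #|U|
    & decode rho_inj psi Bs r_tw w = (Some (codeword rho g), k).
Proof.
have w_err' : hamming (codeword rho g) w <= r_tw by rewrite hamming_sym.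
have [i err_i] := component_few_errors w_err.
pose E := [set x | tnth (component w i) x
                     != tnth (component (codeword rho g) i) x].
(* The radius is at most half the length, so r' leaves room in 'I_n. *)
have r'_le : r' <= #|'I_n|.
  have [[u [v [_ _ _ uvE]]] _] := delta_twP.
  rewrite card_ord r'E -(mulKn n (ltn0Sn l)) leq_div2r // r_twE.
  apply: leq_trans (leq_div _ _) (leq_trans (leq_subr _ _) _).
  by rewrite -uvE hamming_max.
have [|B UB dEB] := uncovering_le (R := psi i @^-1: E) U_ubb r'_le.
  by rewrite card_preimset; [rewrite r'E | apply: perm_inj].
have attemptB : attempt rho_inj psi r_tw w B i = Some (codeword rho g).
  apply: attempt_complete => //.
    by apply: is_base_imset (psi_alpha i) _; apply: U_ubb.1.
  move=> _ /imsetP[b Bb ->].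
  have := disjointFl dEB Bb; rewrite !inE => /negbFE/eqP->.
  by rewrite component_concat tnth_mktuple.
rewrite /decode.
have -> : l.+1 * #|U| = size [seq (B, i) | B <- Bs, i <- enum 'I_l.+1].
  by rewrite size_allpairs (perm_size Bs_order) -cardE size_enum_ord mulnC.
apply: searchP => [[B' j] c /attempt_sound[Cc c_err] | ].
  rewrite r_twE in c_err w_err'.
  by apply: decoding_unique delta_twP Cc _ c_err w_err'; apply: imset_f.
exists (B, i) => //; apply/allpairsP; exists (B, i); split=> //=.
  by rewrite (perm_mem Bs_order) mem_enum.
by rewrite mem_enum.
Qed.
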